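(* Let $\mathcal{A}$ and $\mathcal{B}$ be nondeterministic Büchi automata over the same alphabet $\Sigma$, where every state of $\mathcal{A}$ can reach an accepting state and has at least one outgoing transition. Let $n_b$ be the number of states of $\mathcal{B}$, let $K \geq 2(2n_b+2)^{n_b}2^{n_b}+1$ be a natural number, and let $p_\bot,\varepsilon,\delta\in(0,1)$. If $\mathcal{L}(\mathcal{A})\setminus\mathcal{L}(\mathcal{B})\neq\emptyset$, then the algorithm $\mathsf{IMC}^2$ on input $(\mathcal{A},\mathcal{B},K,p_\bot,\varepsilon,\delta)$ finds a counterexample to the inclusion $\mathcal{L}(\mathcal{A})\subseteq\mathcal{L}(\mathcal{B})$ with positive probability; that is, with positive probability it returns $\mathit{false}$ together with a pair $(u,v)$ such that $uv^\omega\in\mathcal{L}(\mathcal{A})\setminus\mathcal{L}(\mathcal{B})$.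
   Context: A nondeterministic Büchi automaton (NBA) is $(\Sigma, Q, Q_I, T, Q_F)$ with finite alphabet $\Sigma$, finite state set $Q$, non-empty set $Q_I \subseteq Q$ of initial states, transitions $T \subseteq Q\times\Sigma\times Q$, accepting states $Q_F \subseteq Q$. It accepts an $\omega$-word if some run on it starting in $Q_I$ visits $Q_F$ infinitely often; $\mathcal{L}(\cdot)$ is the set of accepted $\omega$-words. $T(q)$ is the set of transitions with source $q$. Let $\mathcal{A} = (\Sigma, Q, Q_I, T, Q_F)$. A finite run is an alternating sequence $q_0 a_0 q_1 \cdots a_{l-1} q_l$ with $q_0\in Q_I$ and $(q_i,a_i,q_{i+1})\in T$ for all $i$. For $K\ge 2$, a finite run $\sigma = q_0 a_0 q_1 \cdots q_n a_n q_{n+1}$ of $\mathcal{A}$ is a $K$-lasso if each state in $\{q_0,\dots,q_n\}$ occurs at most $K-1$ times in $q_0 a_0 \cdots a_{n-1} q_n$, and $q_{n+1} = q_i$ for some $0 \le i \le n$. $\sigma\bot$ denotes the corresponding terminating $K$-lasso, where $\bot$ is a fresh symbol; $S^K_{\mathcal{A}}$ is the set of all terminating $K$-lassos. $\sigma\bot$ is a witness (for $\mathcal{L}(\mathcal{A})\setminus\mathcal{L}(\mathcal{B})\neq\emptyset$) if for some $0 \le i\le n$ with $q_{n+1}=q_i$, the $\omega$-word $uv^\omega$ with $u = a_0\cdots a_{i-1}$, $v = a_i\cdots a_n$ is accepted by $\mathcal{A}$ and not accepted by $\mathcal{B}$. Let $\#(\sigma,q)$ be the number of occurrences of state $q$ in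 $\sigma$. For a finite run, define $\Pr'[q_0] = 1/|Q_I|$, and for $\sigma = \sigma' a_l q_{l+1}$ with $q_l$ the last state of $\sigma'$, $\Pr'[\sigma] = \Pr'[\sigma']\cdot \frac{1}{|T(q_l)|}$ if $\#(\sigma',q_l)=1$ and $\Pr'[\sigma] = (1-p_\bot)\Pr'[\sigma']\cdot\frac{1}{|T(q_l)|}$ if $\#(\sigma',q_l)>1$. For a terminating $K$-lasso $\sigma\bot$ with last state $q_{n+1}$, $\Pr_{p_\bot}[\sigma\bot] = \Pr'[\sigma]$ if $\#(\sigma,q_{n+1})=K$ and $\Pr_{p_\bot}[\sigma\bot] = p_\bot\cdot\Pr'[\sigma]$ if $\#(\sigma,q_{n+1})<K$. This is a probability distribution on the finite set $S^K_{\mathcal{A}}$. Algorithm $\mathsf{IMC}^2(\mathcal{A},\mathcal{B},K,p_\bot,\varepsilon,\delta)$: set $M = \lceil \ln\delta/\ln(1-\varepsilon)\rceil$; repeat $M$ times, independently: sample a terminating $K$-lasso from $S^K_{\mathcal{A}}$ according to $\Pr_{p_\bot}$ and check whether it is a witness by membership tests of an associated $uv^\omega$ in $\mathcal{L}(\mathcal{A})$ and in $\mathcal{L}(\mathcal{B})$; if it is, return $\mathit{false}$ together with a pair $(u,v)$ with $uv^\omega \in \mathcal{L}(\mathcal{A})\setminus\mathcal{L}(\mathcal{B})$. If no sampled lasso is a witness, return $\mathit{true}$. *)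

(* Defs.v *)
From HB Require Import structures.
From mathcomp Require Import all_boot all_order all_algebra.
From mathcomp Require Import all_classical all_reals all_analysis.

Set Implicit Arguments.
Unset Strict Implicit.
Unset Printing Implicit Defensive.

Import Order.TTheory GRing.Theory Num.Theory.

Local Open Scope ring_scope.

Record nba (Sigma : finType) := NBA {
  state : finType;
  init : {set state};
  trans : {set state * Sigma * state};
  final : {set state};
  init_neq0 : (init != finset.set0)%SET
}.

Definition out_trans (Sigma : finType) (A : nba Sigma) (q : state A) :
    {set state A * Sigma * state A} :=
  [set t in trans A | t.1.1 == q]%SET.

Definition edge (Sigma : finType) (A : nba Sigma) : rel (state A) :=
  fun q q' => [exists a, (q, a, q') \in trans A].

Definition accepts (Sigma : finType) (A : nba Sigma) (w : nat -> Sigma) : Prop :=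
  exists r : nat -> state A,
    [/\ r 0%N \in init A,
        forall i, (r i, w i, r i.+1) \in trans A
      & forall n, exists2 m, (n <= m)%N & r m \in final A].

Definition lang (Sigma : finType) (A : nba Sigma) : set (nat -> Sigma) :=
  [set w | accepts A w]%classic.

(* The word u v^omega. The letter a is only a default value for [nth]; it is
   never used when v is non-empty. *)
Definition up_word (Sigma : finType) (a : Sigma) (u v : seq Sigma) : nat -> Sigma :=
  fun i => if (i < size u)%N then nth a u i
           else nth a v ((i - size u) %% size v)%N.

Definition counterexample (Sigma : finType) (A B : nba Sigma) (u v : seq Sigma) :
    Prop :=
  if v is a :: _ then (lang A `\` lang B)%classic (up_word a u v) else False.

(* An alternating sequence q_0 a_0 q_1 ... a_(l-1) q_l is stored as the pair
   (q_0, [:: (a_0, q_1); ...; (a_(l-1), q_l)]). *)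
Definition altseq (Sigma : finType) (A : nba Sigma) : Type :=
  (state A * seq (Sigma * state A))%type.

Definition states (Sigma : finType) (A : nba Sigma) (x : altseq A) : seq (state A) :=
  x.1 :: unzip2 x.2.

Definition letters (Sigma : finType) (A : nba Sigma) (x : altseq A) : seq Sigma :=
  unzip1 x.2.

Definition last_state (Sigma : finType) (A : nba Sigma) (x : altseq A) : state A :=
  last x.1 (unzip2 x.2).

Definition states_but_last (Sigma : finType) (A : nba Sigma) (x : altseq A) :
    seq (state A) :=
  belast x.1 (unzip2 x.2).

Definition prefix_run (Sigma : finType) (A : nba Sigma) (x : altseq A) (l : nat) :
    altseq A :=
  (x.1, take l x.2).

Definition occ (Sigma : finType) (A : nba Sigma) (x : altseq A) (q : state A) : nat :=
  count_mem q (states x).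

Fixpoint trans_path (Sigma : finType) (A : nba Sigma) (q : state A)
    (s : seq (Sigma * state A)) : bool :=
  if s is (a, q') :: s' then ((q, a, q') \in trans A) && trans_path q' s' else true.

Definition finite_run (Sigma : finType) (A : nba Sigma) (x : altseq A) : bool :=
  (x.1 \in init A) && trans_path x.1 x.2.

Definition lasso (Sigma : finType) (A : nba Sigma) (K : nat) (x : altseq A) : bool :=
  [&& finite_run x,
      [forall q, (count_mem q (states_but_last x) <= K.-1)%N]
    & last_state x \in states_but_last x].

(* Carrier of the sample space: by [lasso_size] below, the bound on the length
   excludes no K-lasso. The terminating lasso (sigma, bottom) is identified
   with sigma. *)
Definition bounded_altseq (Sigma : finType) (A : nba Sigma) (K : nat) : finType :=
  (state A * {bseq (#|state A| * K.-1)%N of Sigma * state A})%type.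

Definition to_altseq (Sigma : finType) (A : nba Sigma) (K : nat)
    (x : bounded_altseq A K) : altseq A :=
  (x.1, x.2 : seq (Sigma * state A)).

Definition lassos (Sigma : finType) (A : nba Sigma) (K : nat) :
    {set bounded_altseq A K} :=
  [set x | lasso K (to_altseq x)]%SET.

Lemma lasso_size (Sigma : finType) (A : nba Sigma) (K : nat) (x : altseq A) :
  lasso K x -> (size x.2 <= #|state A| * K.-1)%N.
Proof.
case/and3P=> _ /forallP h _.
have -> : size x.2 = (\sum_(q : state A) count_mem q (states_but_last x))%N.
  rewrite -(size_map snd x.2) -(size_belast x.1) /states_but_last.
  elim: (belast _ _) => [|q s IHs] /=; first by rewrite big1.
  by rewrite big_split /= -IHs (bigD1 q) //= eqxx big1 // => q' /negPf;
    rewrite eq_sym => ->.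
by rewrite -sum_nat_const; apply: leq_sum => q _; apply: h.
Qed.

Lemma lassosP (Sigma : finType) (A : nba Sigma) (K : nat) (x : altseq A) :
  reflect (exists2 y, y \in lassos A K & to_altseq y = x) (lasso K x).
Proof.
apply: (iffP idP) => [hx|[y + <-]]; last by rewrite inE.
by exists (x.1, Bseq (lasso_size hx)); rewrite ?inE /to_altseq /= -surjective_pairing.
Qed.

(* The factor by which Pr' changes when the finite run y is extended by one
   transition. *)
Definition extend_prob (R : realType) (Sigma : finType) (A : nba Sigma) (pbot : R)
    (y : altseq A) : R :=
  (if (1 < occ y (last_state y))%N then 1 - pbot else 1)
    / #|out_trans (last_state y)|%:R.

(* The recursion defining Pr', unrolled; see [run_prob0] and [run_prob_rcons]. *)
Definition run_prob (R : realType) (Sigma : finType) (A : nba Sigma) (pbot : R)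
    (x : altseq A) : R :=
  #|init A|%:R^-1 * \prod_(l < size x.2) extend_prob pbot (prefix_run x l).

Lemma run_prob0 (R : realType) (Sigma : finType) (A : nba Sigma) (pbot : R)
    (q0 : state A) :
  run_prob pbot (q0, [::]) = #|init A|%:R^-1.
Proof. by rewrite /run_prob big_ord0 mulr1. Qed.

Lemma run_prob_rcons (R : realType) (Sigma : finType) (A : nba Sigma) (pbot : R)
    (q0 : state A) (s : seq (Sigma * state A)) (a : Sigma) (q : state A) :
  run_prob pbot (q0, rcons s (a, q)) =
  run_prob pbot (q0, s) * extend_prob pbot (q0, s).
Proof.
rewrite /run_prob /= size_rcons big_ord_recr /= mulrA; congr (_ * _ * _).
  apply: eq_bigr => l _; rewrite /prefix_run /= -cats1 takel_cat //.
  exact: ltnW.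
by rewrite /prefix_run /= -cats1 takel_cat // take_size.
Qed.

Definition lasso_prob (R : realType) (Sigma : finType) (A : nba Sigma) (K : nat)
    (pbot : R) (x : altseq A) : R :=
  if (occ x (last_state x) < K)%N then pbot * run_prob pbot x else run_prob pbot x.

Inductive outcome (Sigma : finType) :=
  | ReturnTrue
  | ReturnFalse (u v : seq Sigma).

Arguments ReturnTrue {Sigma}.

Definition loop_start (Sigma : finType) (A : nba Sigma) (x : altseq A) (i : nat) :
    bool :=
  nth x.1 (states x) i == last_state x.

Definition witness_at (Sigma : finType) (A B : nba Sigma) (x : altseq A) (i : nat) :
    bool :=
  loop_start x i
  && `[< counterexample A B (take i (letters x)) (drop i (letters x)) >].

(* Probability that the outcome lies in E when the loop has m iterations left;
   the successive samples are independent. *)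
Fixpoint imc2_loop (R : realType) (Sigma : finType) (A B : nba Sigma) (K : nat)
    (pbot : R) (m : nat) (E : set (outcome Sigma)) : R :=
  if m is m'.+1 then
    \sum_(x in lassos A K) lasso_prob K pbot (to_altseq x) *
      (if [pick i : 'I_(size (letters (to_altseq x)))
             | witness_at B (to_altseq x) i] is Some i
       then \1_E (ReturnFalse (take i (letters (to_altseq x)))
                              (drop i (letters (to_altseq x))))
       else imc2_loop A B K pbot m' E)
  else \1_E ReturnTrue.

Definition sample_count (R : realType) (eps delta : R) : nat :=
  `|Num.ceil (ln delta / ln (1 - eps))|%N.

Definition imc2_prob (R : realType) (Sigma : finType) (A B : nba Sigma) (K : nat)
    (pbot eps delta : R) (E : set (outcome Sigma)) : R :=
  imc2_loop A B K pbot (sample_count eps delta) E.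

(* Main.v *)
(* Take the product of A with the Kupferman-Vardi complement of B, whose
   (2 n_b + 2)^n_b * 2^n_b states are pairs of a level ranking and a breakpoint
   set; a Boolean flag turns the two acceptance conditions into one. A word in
   L(A) \ L(B) yields an accepting run of the product, hence an accepting lasso
   that repeats no product state before its last one. Projected to A, this lasso
   visits a state at most 2 (2 n_b + 2)^n_b 2^n_b <= K - 1 times, so it is a
   K-lasso; its word is accepted by A and by the complement of B, so it is a
   witness. Every K-lasso has positive probability, and at least one is drawn. *)
Require Import Defs.
From HB Require Import structures.
From mathcomp Require Import all_boot all_order all_algebra.
From mathcomp Require Import all_classical all_reals all_analysis.

Set Implicit Arguments.
Unset Strict Implicit.
Unset Printing Implicit Defensive.

Import Order.TTheory GRing.Theory Num.Theory.

Local Open Scope ring_scope.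

(** * Infinite paths in layered graphs and König's lemma *)

Definition ray (T : Type) (E : nat -> T -> T -> Prop) (P : nat -> T -> Prop)
    (l : nat) (q : T) : Prop :=
  exists r : nat -> T, r 0%N = q /\
    forall i, P (l + i)%N (r i) /\ E (l + i)%N (r i) (r i.+1).

Lemma ray_of_succ (T : Type) (E : nat -> T -> T -> Prop) (P : nat -> T -> Prop)
    (l : nat) (q : T) :
    (forall l q, P l q -> exists2 q', E l q q' & P l.+1 q') ->
  P l q -> ray E P l q.
Proof.
move=> succP Plq.
pose X := {p : nat * T | P p.1 p.2}.
pose S (x y : X) := (sval y).1 = (sval x).1.+1 /\
  E (sval x).1 (sval x).2 (sval y).2.
have [|f [f0 fS]] := @dependent_choice X S _ (exist _ (l, q) Plq).
  move=> [[l1 q1] /= P1]; apply: cid.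
  have [q2 E12 P2] := succP _ _ P1.
  by exists (exist _ (l1.+1, q2) P2).
have lev i : (sval (f i)).1 = (l + i)%N.
  elim: i => [|i IHi]; first by rewrite f0 addn0.
  by rewrite (fS i).1 IHi addnS.
exists (fun i => (sval (f i)).2); rewrite f0; split=> // i.
by rewrite -lev; split; [exact: (svalP (f i)) | apply: (fS i).2].
Qed.

(** If each [q] failed at some stage [N q], antitonicity would leave nothing at stage
    [\max_q N q]. *)
Lemma fin_antitone (T : finType) (Q : nat -> T -> Prop) :
    (forall m q, Q m.+1 q -> Q m q) -> (forall m, exists q, Q m q) ->
  exists q, forall m, Q m q.
Proof.
move=> anti exQ; apply: contrapT => /forallNP noq.
have /choice[N QN] : forall q, exists m, ~ Q m q.
  by move=> q; apply/existsNP; apply: noq.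
have mono m i q : Q (m + i)%N q -> Q m q.
  by elim: i => [|i IHi]; rewrite ?addn0 // addnS => /anti.
have [q] := exQ (\max_q N q)%N.
by rewrite -(subnKC (leq_bigmax q)) => /mono /QN.
Qed.

Fixpoint chain (T : Type) (E : nat -> T -> T -> Prop) (P : nat -> T -> Prop)
    (m l : nat) (q : T) : Prop :=
  P l q /\ if m is m'.+1 then exists2 q', E l q q' & chain E P m' l.+1 q' else True.

(** Walking backwards through predecessors gives chains of every length from level 0. By finiteness
    some vertex starts chains of all lengths, and this property passes to one of its successors. *)
Lemma konig (T : finType) (E : nat -> T -> T -> Prop) (P : nat -> T -> Prop) :
    (forall l, exists q, P l q) ->
    (forall l q', P l.+1 q' -> exists2 q, P l q & E l q q') ->
  exists q, ray E P 0 q.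
Proof.
move=> exP predP.
have anti m : forall l q, chain E P m.+1 l q -> chain E P m l q.
  elim: m => [|m IHm] l q; first by case.
  by case=> Plq [q' Eqq' /IHm]; split=> //; exists q'.
have exC m : forall l, exists q, chain E P m l q.
  elim: m => [|m IHm] l; first by have [q] := exP l; exists q.
  have [q' Cq'] := IHm l.+1.
  have [|q Pq Eqq'] := predP l q'; first by case: (m) Cq' => [|?] [].
  by exists q; split=> //; exists q'.
have [q Cq] := fin_antitone (fun m => @anti m 0%N) (fun m => exC m 0%N).
exists q; have [||r [r0 rP]] := @ray_of_succ T E
    (fun l q => forall m, chain E P m l q) 0 q => // [l {Cq}q Cq|].
  have [|m|q' Cq'] := @fin_antitone T (fun m q' => E l q q' /\ chain E P m l.+1 q').
  - by move=> m q' [? /anti].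
  - by have [_ [q' ? ?]] := Cq m.+1; exists q'.
  - by exists q' => [|m]; have [] := Cq' 0%N => // _ _; have [] := Cq' m.
exists r; split=> // i; have [Pi Ei] := rP i; split=> //.
by have [] := Pi 0%N.
Qed.

(** * Ranks in the run DAG of a rejected word *)

(** Reachability of [F] inside [P] in at most [m] steps; the bound later serves as a countdown. *)
Fixpoint visits (T : finType) (E : nat -> rel T) (F : {set T})
    (P : nat -> T -> Prop) (m l : nat) (q : T) : Prop :=
  P l q /\ (q \in F \/
    if m is m'.+1 then exists2 q', E l q q' & visits E F P m' l.+1 q' else False).

Lemma visits_dom (T : finType) (E : nat -> rel T) (F : {set T})
    (P : nat -> T -> Prop) (m l : nat) (q : T) :
  visits E F P m l q -> P l q.
Proof. by case: m => [|m] []. Qed.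

(* The Kupferman-Vardi filtration of the run DAG: odd stages keep the vertices
   that start an infinite path, even stages those from which F is reachable. *)
Fixpoint alive (T : finType) (E : nat -> rel T) (I F : {set T}) (k : nat) :
    nat -> T -> Prop :=
  if k is k'.+1 then
    if odd k' then fun l q => exists m, visits E F (alive E I F k') m l q
    else ray E (alive E I F k')
  else fun l q => exists r : nat -> T,
    [/\ r 0%N \in I, forall i, (i < l)%N -> E i (r i) (r i.+1) & r l = q].

Lemma alive_dec (T : finType) (E : nat -> rel T) (I F : {set T}) (k l : nat)
    (q : T) :
  alive E I F k.+1 l q -> alive E I F k l q.
Proof.
rewrite /=; case: (odd k) => [[m /visits_dom] //|[r [<- /(_ 0%N)[]]]].
by rewrite addn0.
Qed.

Lemma alive_anti (T : finType) (E : nat -> rel T) (I F : {set T}) (j k l : nat)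
    (q : T) :
  (j <= k)%N -> alive E I F k l q -> alive E I F j l q.
Proof.
by move/subnKC <-; elim: (k - j)%N => [|i IHi]; rewrite ?addn0 // addnS => /alive_dec.
Qed.

Lemma alive_step (T : finType) (E : nat -> rel T) (I F : {set T}) (l : nat)
    (q q' : T) :
  alive E I F 0 l q -> E l q q' -> alive E I F 0 l.+1 q'.
Proof.
case=> r [r0 rE rl] Eqq'; exists (fun i => if (i <= l)%N then r i else q').
split=> [//|i|]; last by rewrite ltnn.
rewrite ltnS => il; rewrite il; case: ltnP => [|li]; first exact: rE.
by have -> : i = l; [apply/eqP; rewrite eqn_leq il | rewrite rl].
Qed.

(** Prepending the edge to a ray, or to a path to [F], from [q'] gives one from [q]; induction on
    [k] keeps it inside the previous stage. *)
Lemma alive_pred (T : finType) (E : nat -> rel T) (I F : {set T}) (k l : nat)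
    (q q' : T) :
    alive E I F 0 l q -> E l q q' -> alive E I F k l.+1 q' ->
  alive E I F k l q.
Proof.
move=> Alq Eqq'; elim: k => [//|k IHk] Aq'.
have Akq := IHk (alive_dec Aq'); move: Aq' => /=.
case: (odd k) => [[m Vm]|[r [r0 rP]]].
  by exists m.+1; split=> //; right; exists q'.
exists (fun i => if i is j.+1 then r j else q); split=> // -[|i].
  by rewrite addn0 r0.
by rewrite addnS -addSn.
Qed.

(** Each vertex carries a bound on its distance to [F]. The bound decreases along an edge unless the
    edge leaves a vertex of [F], where a fresh bound is chosen. *)
Lemma infinite_visits (T : finType) (E : nat -> rel T) (F : {set T})
    (P : nat -> T -> Prop) (l : nat) (q : T) :
    (forall l q, P l q -> exists2 q', E l q q' & P l.+1 q') ->
    (forall l' q', (l <= l')%N -> P l' q' -> exists m, visits E F P m l' q') ->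
    P l q ->
  exists r : nat -> T, [/\ r 0%N = q, forall i, E (l + i)%N (r i) (r i.+1)
    & forall n, exists2 m, (n <= m)%N & r m \in F].
Proof.
move=> succP visP Plq.
pose E' l (x y : T * nat) := E l x.1 y.1 /\ (x.1 \in F \/ (y.2 < x.2)%N).
pose P' l' (x : T * nat) := (l <= l')%N /\ visits E F P x.2 l' x.1.
have [m Vm] := visP _ _ (leqnn l) Plq.
have [|//|r [r0 rP]] := @ray_of_succ _ E' P' l (q, m); last first.
  exists (fst \o r); split=> [|i|n]; [by rewrite /= r0 | by case: (rP i) => _ [] |].
  move: {2}(r n).2 (leqnn (r n).2) => d; elim: d n => [|d IHd] n rnd.
    exists n => //; have [_ [_ [//|]]] := rP n.
    by move: rnd; rewrite leqn0 => /eqP ->.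
  have [_ [_ [?|rS]]] := rP n; first by exists n.
  by have [|k nk kF] := IHd n.+1; [exact: leq_trans rS rnd | exists k => //; exact: ltnW].
move=> l' [q1 [|m1]] /= [ll' [Pq1 [q1F|]]] //.
- have [q2 E12 P2] := succP _ _ Pq1.
  have [m2 V2] := visP _ _ (leqW ll') P2.
  by exists (q2, m2); split=> //=; [left | exact: leqW].
- have [q2 E12 P2] := succP _ _ Pq1.
  have [m2 V2] := visP _ _ (leqW ll') P2.
  by exists (q2, m2); split=> //=; [left | exact: leqW].
- by case=> q2 E12 V2; exists (q2, m1); split=> //=; [right | exact: leqW].
Qed.

Lemma alive_succ (T : finType) (E : nat -> rel T) (I F : {set T}) (k l : nat)
    (q : T) : ~~ odd k -> alive E I F k.+1 l q ->
  exists2 q', E l q q' & alive E I F k.+1 l.+1 q'.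
Proof.
move=> /= /negPf -> [r [<- rP]]; exists (r 1%N).
  by have [] := rP 0%N; rewrite addn0.
exists (fun i => r i.+1); split=> // i.
by have := rP i.+1; rewrite addnS -addSn.
Qed.

Definition rejecting (T : finType) (E : nat -> rel T) (I F : {set T}) : Prop :=
  ~ exists r : nat -> T, [/\ r 0%N \in I, forall i, E i (r i) (r i.+1)
    & forall n, exists2 m, (n <= m)%N & r m \in F].

(** If no vertex of this stage died, each could reach [F] inside it, and [infinite_visits], preceded
    by a path from [I], would give an accepting path. *)
Lemma exists_dying (T : finType) (E : nat -> rel T) (I F : {set T}) (k l : nat)
    (q : T) :
    rejecting E I F -> ~~ odd k -> alive E I F k.+1 l q ->
  exists l' q', alive E I F k.+1 l' q' /\ ~ alive E I F k.+2 l' q'.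
Proof.
move=> rej evk Aq; apply: contrapT => nodie; apply: rej.
have [| |r [r0 rE rF]] := @infinite_visits T E F (alive E I F k.+1) l q _ _ Aq.
- by move=> l' q'; apply: alive_succ.
- move=> l' q' _ Aq'; apply: contrapT => nv; apply: nodie.
  by exists l', q'; split=> //=; rewrite evk.
have [s [s0 sE sl]] := alive_anti (leq0n _) Aq.
exists (fun i => if (i < l)%N then s i else r (i - l)%N); split.
- case: ltnP => // l0; rewrite (_ : l = 0%N) in sl; last by case: (l) l0.
  by rewrite sub0n r0 -sl.
- move=> i; case: (ltnP i l) => [il|li].
    case: ltnP => [|li]; first by move=> _; apply: sE.
    have lE : l = i.+1 by apply/eqP; rewrite eqn_leq li.
    by rewrite lE subnn r0 -sl lE; apply: sE; rewrite lE.
  by rewrite ltnNge (leqW li) /= subSn // -{1}(subnKC li).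
- move=> n; have [m nm mF] := rF n; exists (l + m)%N.
    exact: leq_trans nm (leq_addl _ _).
  by rewrite ltnNge leq_addr /= addKn.
Qed.

(** A dying vertex of stage [i.*2.+1] starts a ray inside stage [i.*2]. By [alive_pred] no vertex of
    that ray is in stage [i.*2.+2], so two stages remove at least one vertex from each late
    level. *)
Lemma alive_width (T : finType) (E : nat -> rel T) (I F : {set T}) (i : nat) :
    rejecting E I F ->
  exists L, forall l, (L <= l)%N ->
    (#|[set q | `[< alive E I F i.*2 l q >]]%SET| <= #|T| - i)%N.
Proof.
move=> rej; elim: i => [|i [L IHi]].
  by exists 0%N => l _; rewrite subn0 max_card.
have ev : ~~ odd i.*2 by rewrite odd_double.
have [[l0 [q0 A0]]|none] := pselect (exists l q, alive E I F i.*2.+1 l q); last first.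
  exists 0%N => l _; rewrite [X in #|pred_of_set X|](_ : _ = finset.set0) ?cards0 //.
  apply/setP => q; rewrite finset.in_set finset.in_set0; apply/asboolP => Aq; apply: none.
  by exists l, q; apply: alive_dec; rewrite -doubleS.
have [l1 [q1 [A1 D1]]] := exists_dying rej ev A0.
have [r [r0 rP]] : ray E (alive E I F i.*2) l1 q1.
  by move: A1 => /=; rewrite (negPf ev).
have Ar j : alive E I F i.*2 (l1 + j) (r j) by have [] := rP j.
have Dr j : ~ alive E I F i.*2.+2 (l1 + j) (r j).
  elim: j => [|j IHj]; first by rewrite addn0 r0.
  move=> Aj; apply: IHj; apply: (@alive_pred _ _ _ _ _ _ _ (r j.+1)).
  - exact: (alive_anti _ (Ar j)).
  - by have [] := rP j.
  - by rewrite -addnS.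
exists (maxn L l1) => l; rewrite geq_max => /andP[Ll l1l].
rewrite subnS -ltnS; apply: leq_trans (leqSpred _).
apply: leq_trans (IHi _ Ll); apply: proper_card; apply/properP; split.
  apply/fintype.subsetP => q; rewrite !finset.in_set => /asboolP Aq; apply/asboolP.
  by apply: (alive_anti _ Aq); rewrite doubleS -addn2 leq_addr.
exists (r (l - l1)%N); rewrite finset.in_set -(subnKC l1l) addKn.
  by apply/asboolP; apply: Ar.
by apply/asboolP; apply: Dr.
Qed.

(** From some level on, stage [#|T|.*2] has width 0, while a ray inside it would meet every level
    after its start. *)
Lemma alive_extinct (T : finType) (E : nat -> rel T) (I F : {set T}) (l : nat)
    (q : T) :
  rejecting E I F -> ~ alive E I F #|T|.*2.+1 l q.
Proof.
move=> /(alive_width #|T|)[L]; rewrite subnn => widthL /=.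
rewrite odd_double => -[r [_ rP]].
have [Ar _] := rP L; have := widthL _ (leq_addl l L).
rewrite leqn0 cards_eq0 => /eqP/setP/(_ (r L)).
by rewrite finset.in_set finset.in_set0 => /asboolP.
Qed.

(** The rank is the last stage that contains the vertex. It does not grow along edges, by
    [alive_pred]. A vertex of [F] of odd rank [k] would lie in stage [k.+1], and so would the start
    of a ray of constant even rank [k]. *)
Lemma exists_odd_ranking (T : finType) (E : nat -> rel T) (I F : {set T}) :
    rejecting E I F ->
  exists rk : nat -> T -> option 'I_(2 * #|T| + 1),
  [/\ forall q, q \in I -> rk 0%N q,
      forall l q q' k, rk l q = Some k -> E l q q' ->
        exists2 k', rk l.+1 q' = Some k' & (k' <= k)%N,
      forall l q k, rk l q = Some k -> odd k -> q \notin F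
    & forall l q k, ray E (fun l q => rk l q = Some k) l q -> odd k].
Proof.
move=> rej; pose A := alive E I F.
pose rk l q := [pick k : 'I_(2 * #|T| + 1) | `[< A k l q /\ ~ A k.+1 l q >]].
have rkE l q k : rk l q = Some k -> A k l q /\ ~ A k.+1 l q.
  by rewrite /rk; case: pickP => // ? /asboolP + [<-].
have rkS l q : A 0%N l q -> exists k, rk l q = Some k.
  move=> A0; rewrite /rk; case: pickP => [k _|no]; first by exists k.
  (* Otherwise [q] passes from each stage to the next, up to stage [2 * #|T| + 1], which is
     empty. *)
  suff AK k : (k <= 2 * #|T| + 1)%N -> A k l q.
    by have := AK _ (leqnn _); rewrite mul2n addn1 => /(alive_extinct rej).
  elim: k => [//|k IHk] kT; apply: contrapT => nA.
  by have /asboolP[] := no (Ordinal kT); split=> //; apply: IHk; apply: ltnW.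
exists rk; split.
- move=> q qI; have [|k ->//] := rkS 0%N q.
  by exists (fun=> q).
- move=> l q q' k /rkE[Ak nAk] Eqq'.
  have A0 := alive_anti (leq0n _) Ak.
  have [k' k'E] := rkS _ _ (alive_step A0 Eqq'); exists k' => //.
  rewrite leqNgt; apply/negP => kk'; apply: nAk; apply: (alive_pred A0 Eqq').
  by apply: (alive_anti kk' _); have [] := rkE _ _ _ k'E.
- move=> l q k /rkE[Ak nAk] ok; apply/negP => qF; apply: nAk.
  by rewrite /A /= ok; exists 0%N; split=> //; left.
- move=> l q k [r [r0 rP]]; apply/negP => /negP/negPf ek.
  have [/rkE[_ dead] _] := rP 0%N; apply: dead.
  rewrite /A /= ek addn0 r0; exists r; split=> // i.
  by have [/rkE[Ai _] Ei] := rP i.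
Qed.

(** * Complementation by level rankings *)

Definition rank_le (m : nat) (o o' : option 'I_m) : bool :=
  if o is Some k then if o' is Some k' then (k' <= k)%N else false else true.

Definition even_rank (m : nat) (o : option 'I_m) : bool :=
  if o is Some k then ~~ odd k else false.

(** Miyano-Hayashi breakpoint: the set tracks the paths whose ranks have stayed even since its last
    refill, and is refilled once it is empty. *)
Definition breakpoint (Sigma : finType) (B : nba Sigma) (m : nat)
    (O : {set state B}) (a : Sigma) (f : state B -> option 'I_m) : {set state B} :=
  [set q' | even_rank (f q') &&
    ((O == finset.set0) || [exists q in O, (q, a, q') \in trans B])]%SET.

(* [None] is the rank of the states of B that are not reachable. *)
Notation level_ranking B := {ffun state B -> option 'I_(2 * #|state B| + 1)}.

Definition complement_init (Sigma : finType) (B : nba Sigma) :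
    {set level_ranking B * {set state B}} :=
  [set c : level_ranking B * {set state B} |
    (c.2 == finset.set0) && [forall q in init B, isSome (c.1 q)]]%SET.

Definition complement_trans (Sigma : finType) (B : nba Sigma) :
    {set (level_ranking B * {set state B}) * Sigma *
         (level_ranking B * {set state B})} :=
  [set t : (level_ranking B * {set state B}) * Sigma * (level_ranking B * {set state B})
     | [&& [forall q, forall q', ((q, t.1.2, q') \in trans B) ==>
                    rank_le (t.1.1.1 q) (t.2.1 q')],
               [forall q in final B, t.1.1.1 q ==> even_rank (t.1.1.1 q)]
             & t.2.2 == breakpoint t.1.1.2 t.1.2 t.2.1]]%SET.

Lemma complement_init_neq0 (Sigma : finType) (B : nba Sigma) :
  complement_init B != finset.set0.
Proof.
have lt0 : (0 < 2 * #|state B| + 1)%N by rewrite addn1.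
apply/set0Pn; exists ([ffun=> Some (Ordinal lt0)], finset.set0).
rewrite finset.in_set eqxx; apply/forall_inP => q _.
by rewrite ffunE.
Qed.

Definition complement (Sigma : finType) (B : nba Sigma) : nba Sigma :=
  {| state := (level_ranking B * {set state B})%type;
     init := complement_init B;
     trans := complement_trans B;
     final := [set c : level_ranking B * {set state B} | c.2 == finset.set0]%SET;
     init_neq0 := complement_init_neq0 B |}.

(** The values of a ranking are [2 * #|state B| + 1] ranks and [None], hence the base
    [2 * #|state B| + 2]. *)
Lemma card_complement (Sigma : finType) (B : nba Sigma) :
  #|state (complement B)| =
  ((2 * #|state B| + 2) ^ #|state B| * 2 ^ #|state B|)%N.
Proof.
rewrite card_prod card_ffun card_option card_ord -[#|{set _}|]cardsT -powersetT.
by rewrite card_powerset cardsT addn1 addn2.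
Qed.

Lemma eventually_constant (k : nat -> nat) :
  (forall i, (k i.+1 <= k i)%N) -> exists i0, forall i, (i0 <= i)%N -> k i = k i0.
Proof.
move=> kS; have kle i j : (i <= j)%N -> (k j <= k i)%N.
  by move/subnKC <-; elim: (j - i)%N => [|d IHd]; rewrite ?addn0 // addnS (leq_trans (kS _)).
have exk : exists n, `[< exists i, k i = n >].
  by exists (k 0%N); apply/asboolP; exists 0%N.
case: (ex_minnP exk) => n /asboolP[i0 ki0] nmin.
exists i0 => i /kle ki; apply/eqP; rewrite eqn_leq ki ki0 nmin //.
by apply/asboolP; exists i.
Qed.

Lemma breakpoint_even (Sigma : finType) (B : nba Sigma) (m : nat)
    (O : {set state B}) (a : Sigma) (f : state B -> option 'I_m) (q : state B) :
  q \in breakpoint O a f -> even_rank (f q).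
Proof. by rewrite finset.in_set => /andP[]. Qed.

(** Along an accepting run of [B] the rank becomes constant, and visits to final states make that
    constant even. The run enters the breakpoint set at its next refill and never leaves it, so the
    set is not emptied again. *)
Lemma complement_sound (Sigma : finType) (B : nba Sigma) (w : nat -> Sigma) :
  accepts (complement B) w -> ~ accepts B w.
Proof.
case=> c [cI cT cF] [r [rI rT rF]].
have step i q q' : (q, w i, q') \in trans B ->
    rank_le ((c i).1 q) ((c i.+1).1 q').
  by move: (cT i); rewrite finset.in_set => /and3P[/forallP/(_ q)/forallP/(_ q')/implyP h _ _].
have fin i q : q \in final B -> (c i).1 q -> even_rank ((c i).1 q).
  by move: (cT i); rewrite finset.in_set => /and3P[_ /forall_inP/(_ q) h _] /h/implyP.
have brk i : (c i.+1).2 = breakpoint (c i).2 (w i) (c i.+1).1.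
  by move: (cT i); rewrite finset.in_set => /and3P[_ _ /eqP].
have rk i : (c i).1 (r i).
  elim: i => [|i].
    by move: cI; rewrite finset.in_set => /andP[_ /forall_inP]; apply.
  by move: (step _ _ _ (rT i)); rewrite /rank_le; case: (_ (r i)) => // k; case: (_ (r i.+1)).
pose k i := if (c i).1 (r i) is Some k then k : nat else 0%N.
have kE i : exists k', (c i).1 (r i) = Some k' /\ k i = k'.
  by rewrite /k; case: (_ (r i)) (rk i) => // k' _; exists k'.
have [i|i0 ki0] := @eventually_constant k.
  move: (step _ _ _ (rT i)); have [k1 [E1 ->]] := kE i.
  by have [k2 [E2 ->]] := kE i.+1; rewrite E1 E2.
have ev i : (i0 <= i)%N -> even_rank ((c i).1 (r i)).
  move=> ii0; have [j i0j /fin/(_ (rk j))] := rF i0.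
  have [k1 [-> /= <-]] := kE j; have [k2 [-> /= <-]] := kE i.
  by rewrite !ki0.
have [j i0j] := cF i0; rewrite finset.in_set => /eqP Oj.
have Or i : r (j + i.+1)%N \in (c (j + i.+1)%N).2.
  elim: i => [|i IHi].
    by rewrite addn1 brk finset.in_set Oj eqxx /= andbT ev // leqW.
  rewrite addnS brk finset.in_set ev /=; last exact: leq_trans i0j (leqW (leq_addr _ _)).
  by apply/orP; right; apply/exists_inP; exists (r (j + i.+1)%N).
have [j' jj'] := cF j.+1; rewrite finset.in_set => /eqP Oj'.
by have := Or (j' - j.+1)%N; rewrite -addSnnS subnKC // Oj' finset.in_set0.
Qed.

(** The odd ranking is the guess; the breakpoint sets are then forced. If they stayed non-empty,
    König's lemma would give a path inside them, with even ranks that become constant, against the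
    oddness of constant ranks. *)
Lemma complement_complete (Sigma : finType) (B : nba Sigma) (w : nat -> Sigma) :
  ~ accepts B w -> accepts (complement B) w.
Proof.
move=> rej; pose E i : rel (state B) := fun q q' => (q, w i, q') \in trans B.
have [rk [rk0 rkS rkF rkI]] := @exists_odd_ranking _ E (init B) (final B) rej.
pose f i : level_ranking B := [ffun q => rk i q].
pose O := fix O i : {set state B} :=
  if i is i'.+1 then breakpoint (O i') (w i') (f i) else finset.set0.
exists (fun i => (f i, O i)); split.
- rewrite finset.in_set eqxx; apply/forall_inP => q qI.
  by rewrite ffunE rk0.
- move=> i; rewrite finset.in_set eqxx andbT; apply/andP; split.
    apply/forallP => q; apply/forallP => q'; apply/implyP => Eqq'.
    rewrite /= !ffunE; case rkq: (rk i q) => [k|//] /=.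
    by have [k' -> ] := rkS _ _ _ _ rkq Eqq'.
  apply/forall_inP => q qF; rewrite /= !ffunE; case rkq: (rk i q) => [k|//] /=.
  by apply/negP => /(rkF _ _ _ rkq); rewrite qF.
- move=> n; apply: contrapT => noF.
  (* Indices start at [n.+1], so that every set considered is a value of [breakpoint]. *)
  have Oneq0 i : O (n.+1 + i)%N != finset.set0.
    apply/negP => Oi; apply: noF; exists (n.+1 + i)%N; last by rewrite finset.in_set.
    by rewrite addSnnS leq_addr.
  have Oeven i q : q \in O (n.+1 + i)%N -> even_rank (rk (n.+1 + i)%N q).
    by rewrite addSn => /breakpoint_even; rewrite ffunE.
  have [|i q'|q0 [r [_ rP]]] := @konig _ (fun i => E (n.+1 + i)%N)
      (fun i q => q \in O (n.+1 + i)%N).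
  + by move=> i; apply/set0Pn.
  + rewrite addnS finset.in_set (negPf (Oneq0 i)) => /andP[_ /exists_inP[q]].
    by exists q.
  pose k i := if rk (n.+1 + i)%N (r i) is Some k then k : nat else 0%N.
  have kE i : exists k', [/\ rk (n.+1 + i)%N (r i) = Some k', k i = k' & ~~ odd k'].
    rewrite /k; have [/Oeven] := rP i.
    by case: (rk _ _) => // k' ev _; exists k'.
  have [i|i0 ki0] := @eventually_constant k.
    have [_ Ei] := rP i; have [k1 [E1 -> _]] := kE i.
    have [k2 [E2 -> _]] := kE i.+1; have [k3] := rkS _ _ _ _ E1 Ei.
    by rewrite -addnS E2 => -[->].
  have [k0 [E0 k0E ev]] := kE i0; move/negP: ev; apply.
  apply: (rkI (n.+1 + i0)%N (r i0)); exists (fun i => r (i0 + i)%N).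
  rewrite addn0; split=> // i; rewrite -[in X in X /\ _]addnA -[in X in _ /\ X]addnA.
  rewrite [in X in _ /\ X]addnS; split; last by have [] := rP (i0 + i)%N.
  have [k1 [-> k1E _]] := kE (i0 + i)%N; congr Some; apply: val_inj.
  by rewrite /= -k1E -k0E ki0 ?leq_addr.
Qed.

(** * Intersection of two Büchi automata *)

(* The flag of a product state tells which automaton has to accept next:
   [false] for A, [true] for C. *)
Definition product_init (Sigma : finType) (A C : nba Sigma) :
    {set state A * (state C * bool)} :=
  [set c : state A * (state C * bool) |
    [&& c.1 \in init A, c.2.1 \in init C & ~~ c.2.2]]%SET.

Definition product_flag (Sigma : finType) (A C : nba Sigma)
    (c : state A * (state C * bool)) : bool :=
  if c.2.2 then c.2.1 \notin final C else c.1 \in final A.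

Definition product_trans (Sigma : finType) (A C : nba Sigma) :
    {set (state A * (state C * bool)) * Sigma * (state A * (state C * bool))} :=
  [set t : (state A * (state C * bool)) * Sigma * (state A * (state C * bool)) |
    [&& (t.1.1.1, t.1.2, t.2.1) \in trans A,
        (t.1.1.2.1, t.1.2, t.2.2.1) \in trans C
      & t.2.2.2 == product_flag t.1.1]]%SET.

Lemma product_init_neq0 (Sigma : finType) (A C : nba Sigma) :
  product_init A C != finset.set0.
Proof.
have /set0Pn[q qI] := init_neq0 A; have /set0Pn[c cI] := init_neq0 C.
by apply/set0Pn; exists (q, (c, false)); rewrite finset.in_set /= qI cI.
Qed.

Definition product (Sigma : finType) (A C : nba Sigma) : nba Sigma :=
  {| state := (state A * (state C * bool))%type;
     init := product_init A C;
     trans := product_trans A C;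
     final := [set c : state A * (state C * bool) |
                 c.2.2 && (c.2.1 \in final C)]%SET;
     init_neq0 := product_init_neq0 A C |}.

(** The flag falls after each final state of the product and rises only after a final state of [A],
    so two visits to the former enclose one to the latter. *)
Lemma accepts_productl (Sigma : finType) (A C : nba Sigma) (w : nat -> Sigma) :
  accepts (product A C) w -> accepts A w.
Proof.
case=> r [rI rT rF]; exists (fun i => (r i).1); split.
- by move: rI; rewrite finset.in_set => /and3P[].
- by move=> i; move: (rT i); rewrite finset.in_set => /and3P[].
move=> n; apply: contrapT => noF.
have flag i : (r i.+1).2.2 = product_flag (r i).
  by move: (rT i); rewrite finset.in_set => /and3P[_ _ /eqP].
have [m nm] := rF n; rewrite finset.in_set => /andP[bm cm].
have off d : (r (m.+1 + d)%N).2.2 = false.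
  elim: d => [|d IHd]; first by rewrite addn0 flag /product_flag bm cm.
  rewrite addnS flag /product_flag IHd; apply/negP => rd; apply: noF.
  by exists (m.+1 + d)%N => //; rewrite addSn leqW // (leq_trans nm) ?leq_addr.
have [m' mm'] := rF m.+1; rewrite finset.in_set.
by rewrite -(subnKC mm') off.
Qed.

Lemma accepts_productr (Sigma : finType) (A C : nba Sigma) (w : nat -> Sigma) :
  accepts (product A C) w -> accepts C w.
Proof.
case=> r [rI rT rF]; exists (fun i => (r i).2.1); split.
- by move: rI; rewrite finset.in_set => /and3P[].
- by move=> i; move: (rT i); rewrite finset.in_set => /and3P[].
by move=> n; have [m nm] := rF n; rewrite finset.in_set => /andP[_]; exists m.
Qed.

(** The two runs determine the flag. Suppose no final product state occurs from time [n] on. A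
    raised flag would stay up until [C] accepts, which is such a state; so the flag is down,
    although the next final state of [A] raises it. *)
Lemma accepts_product (Sigma : finType) (A C : nba Sigma) (w : nat -> Sigma) :
  accepts A w -> accepts C w -> accepts (product A C) w.
Proof.
case=> r [rI rT rF] [s [sI sT sF]].
pose b := fix b i := if i is j.+1 then
    product_flag (r j, (s j, b j)) : bool else false.
exists (fun i => (r i, (s i, b i))); split.
- by rewrite finset.in_set /= rI sI.
- by move=> i; rewrite finset.in_set /= rT sT eqxx.
move=> n; apply: contrapT => noF.
have noC i : (n <= i)%N -> b i -> s i \notin final C.
  move=> ni bi; apply/negP => si; apply: noF; exists i => //.
  by rewrite finset.in_set /= bi.
have off i : (n <= i)%N -> b i = false.
  move=> ni; apply/negP => bi.
  have on d : b (i + d)%N.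
    elim: d => [|d IHd]; rewrite ?addn0 // addnS /= /product_flag /= IHd.
    by apply: noC => //; rewrite (leq_trans ni) ?leq_addr.
  have [m im] := sF i; apply/negP; apply: noC; first exact: leq_trans im.
  by rewrite -(subnKC im).
have [m nm rm] := rF n; have := off m.+1 (leqW nm).
by rewrite /= /product_flag /= off // rm.
Qed.

(** * Accepting lassos and their periodic words *)

(** Since [edge] forgets the letters, paths can be shortened and rotated as lists of states; the
    letters are restored here. *)
Lemma trans_path_of_edges (Sigma : finType) (A : nba Sigma) (q : state A)
    (p : seq (state A)) :
  path (@edge Sigma A) q p -> exists s, unzip2 s = p /\ trans_path q s.
Proof.
elim: p q => [|q' p IHp] q /=; first by exists [::].
case/andP=> /existsP[a qaq'] /IHp[s [<- sP]].
by exists ((a, q') :: s); rewrite /= qaq'.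
Qed.

Lemma trans_path_nth (Sigma : finType) (A : nba Sigma) (d q : state A) (a : Sigma)
    (s : seq (Sigma * state A)) (p : nat) :
    trans_path q s -> (p < size s)%N ->
  (nth d (q :: unzip2 s) p, nth a (unzip1 s) p, nth d (unzip2 s) p) \in trans A.
Proof.
elim: s q p => [//|[b q'] s IHs] q [|p] /= /andP[qbq' sP] //.
exact: IHs.
Qed.

Lemma connect_run (Sigma : finType) (A : nba Sigma) (w : nat -> Sigma)
    (r : nat -> state A) (i j : nat) :
    (forall i, (r i, w i, r i.+1) \in trans A) -> (i <= j)%N ->
  connect (@edge Sigma A) (r i) (r j).
Proof.
move=> rT /subnKC <-; elim: (j - i)%N => [|d IHd]; first by rewrite addn0.
apply: connect_trans IHd (connect1 _); rewrite addnS.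
by apply/existsP; exists (w (i + d)%N); apply: rT.
Qed.

(** A recurring final state lies on a simple cycle and ends a simple path from the initial state.
    The path is cut where it first meets the cycle, so that no state repeats before the closing
    one. *)
Lemma exists_simple_lasso (Sigma : finType) (A : nba Sigma) (w : nat -> Sigma) :
    accepts A w ->
  exists x : altseq A, exists i j : nat,
    [/\ finite_run x, uniq (states_but_last x), loop_start x i,
        (i <= j < size x.2)%N & nth x.1 (states x) j \in final A].
Proof.
case=> r [rI rT rF].
have [|n|s sF] := @fin_antitone _ (fun n s => exists m,
    [/\ (n <= m)%N, r m = s & s \in final A]).
- by move=> n s [m [nm ? ?]]; exists m; rewrite ltnW.
- by have [m nm mF] := rF n; exists (r m), m.
have [i [_ ri sfin]] := sF 0%N; have [j [ij rj _]] := sF i.+1.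
have /connectP[p0 + p0s] : connect (@edge Sigma A) (r 0%N) s.
  by rewrite -ri; apply: connect_run rT _.
have /connectP[p + ps] : connect (@edge Sigma A) (r i.+1) s.
  by rewrite -rj; apply: connect_run rT ij.
move=> pP; move: ps; case: (shortenP pP) => {p pP} p pP up _ ps.
move=> p0P; move: p0s; case: (shortenP p0P) => {p0 p0P} p0 p0P up0 _ p0s.
pose c := r i.+1 :: p.
have sc : s \in c by rewrite ps mem_last.
have cc : cycle (@edge Sigma A) c.
  rewrite /= rcons_path pP -ps; apply/existsP; exists (w i).
  by rewrite -ri; apply: rT.
have : has (mem c) (r 0%N :: p0).
  by apply/hasP; exists s; rewrite // p0s mem_last.
move Ep0 : (r 0%N :: p0) => l0 p0c; move: Ep0.
(* [y] is the first state of the path on the cycle; the part [s1] before it avoids the cycle. *)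
case: {p0c}_ / (split_find p0c) => y s1 s2 yc s1c Ep0.
have [n c' rotc] := rot_to yc.
have s1P : path (@edge Sigma A) (r 0%N) (behead (rcons s1 y)).
  move: p0P Ep0; case: (s1) => [|q s3] //= + [_ Ep0].
  by rewrite Ep0 cat_path => /andP[].
have yc'P : path (@edge Sigma A) y (rcons c' y).
  by rewrite -[path _ _ _]/(cycle _ (y :: c')) -rotc rot_cycle.
have us1 : uniq (s1 ++ y :: c').
  rewrite cat_uniq -rotc rot_uniq /c up andbT.
  move: up0; rewrite Ep0 cat_uniq rcons_uniq -!andbA => /and3P[_ -> _] /=.
  apply/hasPn => z; rewrite mem_rot => zc; apply/negP => zs1.
  by move/hasPn/(_ z zs1): s1c => /negP; apply.
(* If [s1] is empty, the initial state [y] is already on the cycle. *)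
have s1h : head y s1 = r 0%N by move: Ep0; case: (s1) => [|? ?] [].
pose P := behead (rcons (s1 ++ y :: c') y).
have EP : r 0%N :: P = rcons (s1 ++ y :: c') y.
  by rewrite /P -s1h; case: (s1).
have PP : path (@edge Sigma A) (r 0%N) P.
  move: s1P; rewrite /P -s1h; case: (s1) => [|q s3] //=.
  by rewrite rcons_cat cat_path rcons_path /= => /andP[-> ->].
have [x2 [x2P x2T]] := trans_path_of_edges PP.
have := EP; rewrite lastI => /rcons_inj[beP laP].
have sizex2 : size x2 = (size s1 + (size c').+1)%N.
  by rewrite -(size_map snd) -/(unzip2 x2) x2P -(size_belast (r 0%N)) beP size_cat.
(* The loop starts at the first occurrence of [y]; [j] is the position of the final state [s] in
   it. *)
exists (r 0%N, x2), (size s1), (size s1 + index s (y :: c'))%N.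
rewrite /finite_run rI x2T /states_but_last /loop_start /states /last_state /= x2P.
have syc : s \in y :: c' by rewrite -rotc mem_rot.
have isyc : (index s (y :: c') < (size c').+1)%N by rewrite index_mem.
rewrite beP laP EP sizex2 us1 leq_addr ltn_add2l isyc; split=> //.
  by rewrite rcons_cat nth_cat ltnn subnn.
by rewrite rcons_cat nth_cat ltnNge leq_addr addKn nth_rcons isyc nth_index.
Qed.

(** The run goes round the loop forever, and [i <= j] puts a final state in the loop. *)
Lemma accepts_lasso (Sigma : finType) (A : nba Sigma) (x : altseq A) (i j : nat)
    (a : Sigma) :
    finite_run x -> loop_start x i -> (i <= j < size x.2)%N ->
    nth x.1 (states x) j \in final A ->
  accepts A (up_word a (take i (letters x)) (drop i (letters x))).
Proof.
case: x => q s /= /andP[/= qI sT]; rewrite /loop_start /last_state /= => /eqP loop.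
move=> /andP[ij js] jF; set n := (size s - i)%N.
have n_gt0 : (0 < n)%N by rewrite subn_gt0 (leq_ltn_trans ij).
have ni : (i + n)%N = size s by rewrite subnKC // ltnW // (leq_ltn_trans ij).
have szu : size (unzip1 s) = size s by rewrite size_map.
pose pos t := if (t < i)%N then t else (i + (t - i) %% n)%N.
have poslt t : (pos t < size s)%N.
  rewrite /pos; case: (ltnP t i) => [ti|_]; last by rewrite -ni ltn_add2l ltn_mod.
  exact: ltn_trans ti (leq_ltn_trans ij js).
have upE t : up_word a (take i (unzip1 s)) (drop i (unzip1 s)) t = nth a (unzip1 s) (pos t).
  rewrite /up_word size_takel; last by rewrite szu -ni leq_addr.
  rewrite size_drop szu -/n /pos; case: ltnP => [ti|ti]; first by rewrite nth_take.
  by rewrite nth_drop.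
(* The position [pos t] read at time [t] advances by one or, after the last letter, returns to [i],
   where the state is the last one of the lasso. *)
have posS t : pos t.+1 = (pos t).+1 \/ (pos t).+1 = size s /\ pos t.+1 = i.
  rewrite /pos; case: (ltnP t i) => [ti|it].
    case: ltnP => ti'; first by left.
    have -> : i = t.+1 by apply/eqP; rewrite eqn_leq ti'.
    by rewrite subnn mod0n addn0; left.
  rewrite ltnNge leqW //= subSn // modnS; case: ifP => [nd|_]; last by left; rewrite addnS.
  right; rewrite addn0; split=> //; rewrite -ni -addnS; congr addn.
  apply/eqP; rewrite eqn_leq ltn_mod n_gt0 /=.
  apply: dvdn_leq => //; move: nd; rewrite /dvdn -addn1 -(modnDml (t - i)) addn1.
  by [].
exists (fun t => nth q (q :: unzip2 s) (pos t)); split.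
- rewrite /pos; case: ltnP => // i0.
  by move: i0; rewrite leqn0 => /eqP ->; rewrite subnn mod0n.
- move=> t; rewrite upE.
  have -> : nth q (q :: unzip2 s) (pos t.+1) = nth q (unzip2 s) (pos t).
    have [-> //|[sE ->]] := posS t.
    by rewrite loop (last_nth q) size_map -sE.
  exact: trans_path_nth.
- move=> m; exists (j + m * n)%N; first by rewrite (leq_trans (leq_pmulr _ n_gt0)) // leq_addl.
  rewrite /pos ltnNge (leq_trans ij) ?leq_addr //= -addnBAC // [(j - i + _)%N]addnC modnMDl.
  by rewrite modn_small ?subnKC // ltn_sub2r // (leq_ltn_trans ij).
Qed.

(** * Projection of product lassos to the first automaton *)

Definition product_fst (Sigma : finType) (A C : nba Sigma)
    (x : altseq (product A C)) : altseq A :=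
  (x.1.1, [seq (y.1, y.2.1) | y <- x.2]).

Lemma states_product_fst (Sigma : finType) (A C : nba Sigma)
    (x : altseq (product A C)) :
  states (product_fst x) = map fst (states x).
Proof. by rewrite /states /= /unzip2 -!map_comp. Qed.

Lemma letters_product_fst (Sigma : finType) (A C : nba Sigma)
    (x : altseq (product A C)) :
  letters (product_fst x) = letters x.
Proof. by rewrite /letters /unzip1 -map_comp. Qed.

Lemma states_but_last_product_fst (Sigma : finType) (A C : nba Sigma)
    (x : altseq (product A C)) :
  states_but_last (product_fst x) = map fst (states_but_last x).
Proof.
case: x => q s; rewrite /states_but_last /product_fst /=.
by elim: s q => //= -[a q'] s IHs q; rewrite IHs.
Qed.

Lemma last_state_product_fst (Sigma : finType) (A C : nba Sigma)
    (x : altseq (product A C)) :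
  last_state (product_fst x) = (last_state x).1.
Proof.
case: x => q s; rewrite /last_state /product_fst /=.
by elim: s q => //= -[a q'] s IHs q; rewrite IHs.
Qed.

Lemma finite_run_product_fst (Sigma : finType) (A C : nba Sigma)
    (x : altseq (product A C)) :
  finite_run x -> finite_run (product_fst x).
Proof.
case: x => q s /andP[]; rewrite /= finset.in_set => /and3P[qI _ _] sP.
rewrite /finite_run /= qI /=; elim: s q {qI} sP => //= -[a q'] s IHs q.
by case/andP; rewrite finset.in_set => /and3P[-> _ _] /IHs.
Qed.

Lemma count_mem_map_fst (T1 T2 : finType) (s : seq (T1 * T2)) (q : T1) :
  uniq s -> (count_mem q (map fst s) <= #|T2|)%N.
Proof.
move=> us; rewrite count_map -size_filter -(size_map snd).
set t := map snd _; have /card_uniqP <- : uniq t; last exact: max_card.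
rewrite map_inj_in_uniq ?filter_uniq // => -[q1 c1] [q2 c2].
by rewrite !mem_filter /= => /andP[/eqP-> _] /andP[/eqP-> _] ->.
Qed.

Lemma loop_start_product_fst (Sigma : finType) (A C : nba Sigma)
    (x : altseq (product A C)) (i : nat) :
  (i < size x.2)%N -> loop_start x i -> loop_start (product_fst x) i.
Proof.
move=> ix /eqP xi; rewrite /loop_start last_state_product_fst -xi.
by rewrite states_product_fst (nth_map x.1) //= size_map ltnW.
Qed.

(** Product states over one state of [A] differ in the state of [C] or in the flag, hence the bound
    [#|state C| * 2]. *)
Lemma lasso_product_fst (Sigma : finType) (A C : nba Sigma) (K : nat)
    (x : altseq (product A C)) (i : nat) :
    (#|state C| * 2 <= K.-1)%N -> finite_run x -> uniq (states_but_last x) ->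
    (i < size x.2)%N -> loop_start x i ->
  lasso K (product_fst x).
Proof.
move=> CK xP ux ix /eqP xi; apply/and3P; split; first exact: finite_run_product_fst.
- apply/forallP => q; rewrite states_but_last_product_fst.
  by apply: leq_trans (count_mem_map_fst _ ux) _; rewrite card_prod card_bool.
- rewrite states_but_last_product_fst last_state_product_fst map_f // -xi.
  rewrite /states lastI nth_rcons size_belast size_map ix mem_nth //.
  by rewrite size_belast size_map.
Qed.

Lemma exists_witness (Sigma : finType) (A B : nba Sigma) (K : nat) :
    (2 * (2 * #|state B| + 2) ^ #|state B| * 2 ^ #|state B| + 1 <= K)%N ->
    (lang A `\` lang B !=set0)%classic ->
  exists x i, [/\ lasso K x, (i < size (letters x))%N & @witness_at Sigma A B x i].
Proof.
move=> KB [w [wA wB]].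
have [x [i [j [xP ux xi ijx jF]]]] :=
  exists_simple_lasso (accepts_product wA (complement_complete wB)).
have ix : (i < size x.2)%N by case/andP: ijx; exact: leq_ltn_trans.
exists (product_fst x), i; split.
- apply: (@lasso_product_fst _ _ _ K x i) => //.
  by rewrite card_complement; move: KB; rewrite addn1 -mulnA mulnC; case: (K).
- by rewrite letters_product_fst size_map.
apply/andP; split; first exact: loop_start_product_fst.
apply/asboolP; rewrite letters_product_fst /counterexample.
(* The loop word is non-empty, and its first letter [a] is the default letter of [up_word]. *)
case Ev: (drop i (letters x)) => [|a v].
  by move: ix; rewrite -(size_map fst x.2) -subn_gt0 -size_drop -[map _ _]/(letters x) Ev.
have acc := accepts_lasso a xP xi ijx jF; rewrite Ev in acc; split.
  exact: accepts_productl acc.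
exact: (complement_sound (accepts_productr acc)).
Qed.

(** * Positive probability of drawing a witness *)

(** Every factor is positive: [pbot], [1 - pbot], and the inverses of the number of initial states
    and of the out-degrees. *)
Lemma lasso_prob_gt0 (R : realType) (Sigma : finType) (A : nba Sigma) (K : nat)
    (pbot : R) (x : altseq A) :
    (forall q : state A, (0 < #|out_trans q|)%N) -> 0 < pbot < 1 ->
  0 < lasso_prob K pbot x.
Proof.
move=> out /andP[p0 p1].
have run0 : 0 < run_prob pbot x.
  rewrite /run_prob mulr_gt0 ?invr_gt0 ?ltr0n ?card_gt0 ?init_neq0 //.
  apply: prodr_gt0 => l _; rewrite divr_gt0 ?ltr0n //.
  by case: ifP; rewrite ?subr_gt0.
by rewrite /lasso_prob; case: ifP => _ //; apply: mulr_gt0.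
Qed.

Lemma imc2_loop_ge0 (R : realType) (Sigma : finType) (A B : nba Sigma) (K : nat)
    (pbot : R) (m : nat) (E : set (outcome Sigma)) :
    (forall q : state A, (0 < #|out_trans q|)%N) -> 0 < pbot < 1 ->
  0 <= imc2_loop A B K pbot m E.
Proof.
move=> out p01; elim: m => [|m IHm] /=; first by rewrite indicE ler0n.
apply: sumr_ge0 => x _; apply: mulr_ge0; first exact/ltW/lasso_prob_gt0.
by case: pickP => // i _; rewrite indicE ler0n.
Qed.

(** Both logarithms are negative, so the quotient is positive and its ceiling at least 1: a sample
    is drawn. *)
Lemma sample_count_gt0 (R : realType) (eps delta : R) :
  0 < eps < 1 -> 0 < delta < 1 -> (0 < sample_count eps delta)%N.
Proof.
move=> /andP[e0 e1] d01; rewrite /sample_count absz_gt0 gt_eqF // ceil_gt0.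
by rewrite nmulr_rgt0 ?invr_lt0 ln_lt0 // subr_gt0 e1 ltrBlDr ltrDl e0.
Qed.

Theorem proposition1 (R : realType) (Sigma : finType) (A B : nba Sigma)
    (K : nat) (pbot eps delta : R)
    (reach_final : forall q : state A,
        exists2 f, f \in final A & connect (@edge Sigma A) q f)
    (has_out : forall q : state A, (0 < #|out_trans q|)%N)
    (K_large : (2 * (2 * #|state B| + 2) ^ #|state B| * 2 ^ #|state B| + 1
                <= K)%N)
    (pbot01 : 0 < pbot < 1) (eps01 : 0 < eps < 1) (delta01 : 0 < delta < 1)
    (not_incl : (lang A `\` lang B !=set0)%classic) :
  0 < imc2_prob A B K pbot eps delta
        [set o | exists u v, o = ReturnFalse u v /\ counterexample A B u v]%classic.
Proof.
have [x [i [/lassosP[y yL <-] ix wit]]] := exists_witness K_large not_incl.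
rewrite /imc2_prob; have := sample_count_gt0 eps01 delta01.
case: (sample_count eps delta) => // m _ /=.
(* Isolate the event that the first sample is the witness [y]; the other terms are non-negative. *)
rewrite (bigD1 y) //= ltr_pwDl //; last first.
  apply: sumr_ge0 => z _; apply: mulr_ge0; first exact/ltW/lasso_prob_gt0.
  case: pickP => [? _|_]; first by rewrite indicE ler0n.
  exact: imc2_loop_ge0.
apply: mulr_gt0; first exact: lasso_prob_gt0.
(* The index [k] picked may differ from [i], but [witness_at] holds there too; [i] shows that the
   pick succeeds. *)
case: pickP => [k /andP[_ /asboolP cex]|/(_ (Ordinal ix))]; last by rewrite wit.
rewrite indicE mem_set ?ltr01 //.
by exists (take k (letters (to_altseq y))), (drop k (letters (to_altseq y))).
Qed.
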